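(* Let $d\ge0$. The integral Schur algebra $S_{\mathbb{Z}}(2,d)$, viewed inside $S_{\mathbb{Q}}(2,d)$, coincides with the subring of $S_{\mathbb{Q}}(2,d)$ generated by all divided powers $e^{(m)}=e^m/m!$ and $f^{(m)}=f^m/m!$ ($m\ge 0$). Moreover, $S_{\mathbb{Z}}(2,d)$ has a $\mathbb{Z}$-basis consisting of all $$f^{(a)}\binom{H_2}{b}e^{(c)}\qquad (a,b,c\ge 0,\ a+b+c\le d),$$ and another $\mathbb{Z}$-basis consisting of all $$e^{(a)}\binom{H_1}{b}f^{(c)}\qquad (a,b,c\ge 0,\ a+b+c\le d).$$
   Context: Let $E=\mathbb{Q}^2$ with standard basis $e_1,e_2$ and let $E_{\mathbb{Z}}=\mathbb{Z}e_1\oplus\mathbb{Z}e_2$. Let $\rho_d:U(\mathfrak{gl}_2)\to\mathrm{End}_{\mathbb{Q}}(E^{\otimes d})$ be the representation of the universal enveloping algebra of $\mathfrak{gl}_2(\mathbb{Q})$ in which $x\in\mathfrak{gl}_2$ acts as $\sum_{i=1}^d 1\otimes\cdots\otimes x\otimes\cdots\otimes 1$ ($x$ in the $i$-th slot); its image is the rational Schur algebra $S_{\mathbb{Q}}(2,d)$ (equal to the image of the group algebra of $GL_2(\mathbb{Q})$ acting diagonally, and to $\mathrm{End}_{\mathbb{Q}\Sigma_d}(E^{\otimes d})$, $\Sigma_d$ acting by place permutations). The integral Schur algebra is $S_{\mathbb{Z}}(2,d)=\mathrm{End}_{\mathbb{Z}\Sigma_d}(E_{\mathbb{Z}}^{\otimes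 d})$, regarded as a subring of $S_{\mathbb{Q}}(2,d)$ by extension of scalars. Write $e,f,H_1,H_2$ for the images under $\rho_d$ of the matrix units $e_{12},e_{21},e_{11},e_{22}$ respectively. For an element $T$ of a $\mathbb{Q}$-algebra and an integer $m\ge0$, $T^{(m)}=T^m/m!$ and $\binom{T}{m}=T(T-1)\cdots(T-m+1)/m!$. *)

(* Defs.v *)
From HB Require Import structures.
From mathcomp Require Import all_boot all_order all_algebra all_fingroup.
Set Implicit Arguments. Unset Strict Implicit. Unset Printing Implicit Defensive.
Import Order.TTheory GRing.Theory Num.Theory.
Local Open Scope ring_scope.

(* Dimension of E^{(x)d}: 2^d, written as a syntactic successor so that
   square matrices of this size carry MathComp's ring structure. *)
Notation Nd d := ((2 ^ d).-1.+1)%N.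

(* Basis of E^{(x)d}: vectors e_{w_0} (x) ... (x) e_{w_{d-1}} indexed by
   i < 2^d; the k-th tensor factor of basis vector i is e_1 if bit k of i
   is 0 (false) and e_2 if it is 1 (true). *)
Definition bitk (k i : nat) : bool := odd (i %/ 2 ^ k).

(* index in {0,1} of the 2x2 matrix row/column: e_1 <-> 0, e_2 <-> 1 *)
Definition b2o (b : bool) : 'I_2 := if b then ord_max else ord0.

(* rho_d(x) for x in gl_2(Q): sum over slots k of 1 (x) .. (x) x (x) .. (x) 1,
   as a matrix acting on column vectors (entry (i,j) = coefficient of the
   basis vector i in the image of basis vector j). *)
Definition rho (d : nat) (x : 'M[rat]_2) : 'M[rat]_(Nd d) :=
  \matrix_(i, j) \sum_(k < d)
     (if [forall l : 'I_d, (l != k) ==> (bitk l i == bitk l j)]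
      then x (b2o (bitk k i)) (b2o (bitk k j)) else 0).

Definition Ee d := rho d (delta_mx 0 1).
Definition Ff d := rho d (delta_mx 1 0).
Definition H1 d := rho d (delta_mx 0 0).
Definition H2 d := rho d (delta_mx 1 1).

Definition dpow (n : nat) (T : 'M[rat]_n.+1) (m : nat) : 'M[rat]_n.+1 :=
  (m`!%:R)^-1 *: T ^+ m.

Definition binomT (n : nat) (T : 'M[rat]_n.+1) (m : nat) : 'M[rat]_n.+1 :=
  (m`!%:R)^-1 *: \prod_(i < m) (T - i%:R).

Definition placeP (d : nat) (s : 'S_d) : 'M[rat]_(Nd d) :=
  \matrix_(i, j) (if [forall k : 'I_d, bitk k i == bitk (s k) j] then 1 else 0).

(* S_Z(2,d) = End_{Z Sigma_d}(E_Z^{(x)d}) inside End_Q(E^{(x)d}):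
   matrices (in the standard Z-basis) with integer entries commuting with
   all place permutations. *)
Definition SZ (d : nat) (M : 'M[rat]_(Nd d)) : Prop :=
  (forall i j, M i j \is a Num.int) /\ (forall s : 'S_d, M * placeP s = placeP s * M).

Inductive gen_dp (d : nat) : 'M[rat]_(Nd d) -> Prop :=
  | gen_one : gen_dp 1
  | gen_e (m : nat) : gen_dp (dpow (Ee d) m)
  | gen_f (m : nat) : gen_dp (dpow (Ff d) m)
  | gen_add A B : gen_dp A -> gen_dp B -> gen_dp (A + B)
  | gen_opp A : gen_dp A -> gen_dp (- A)
  | gen_mul A B : gen_dp A -> gen_dp B -> gen_dp (A * B).

Definition is_Zbasis (n : nat) (P : 'M[rat]_n -> Prop) (I : finType)
    (sel : pred I) (B : I -> 'M[rat]_n) : Prop :=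
  [/\ forall i, sel i -> P (B i),
      forall M, P M -> exists c : I -> int, M = \sum_(i | sel i) (c i)%:~R *: B i
    & forall c : I -> int, \sum_(i | sel i) (c i)%:~R *: B i = 0 ->
        forall i, sel i -> c i = 0].

Definition triple_ok (d : nat) (t : 'I_d.+1 * 'I_d.+1 * 'I_d.+1) : bool :=
  (t.1.1 + t.1.2 + t.2 <= d)%N.

(* Main.v *)
(* Index the standard basis of the tensor power by the subsets [A] of the set of
   slots (those carrying e_2), so that operators are matrices with entries
   [F A B].  Then e^(m) is the 0/1 matrix of the relation [A \subset B],
   [#|B :\: A| = m], f^(m) is its conjugate under complementation, and
   binom(H_2, b) is diagonal with entries 'C(#|A|, b).  The integral Schur
   algebra consists of the integer combinations of the orbit sums, indexed by
   the sizes of [A :\: B], [A :&: B], [B :\: A].  Counting the intermediate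
   subsets shows that f^(a) binom(H_2, b) e^(c) is the orbit sum of type
   (a, b, c) plus orbit sums of types with smaller a, or the same a and larger b,
   whence the basis; the second basis is its image under complementation.
   These products lie in the subring generated by divided powers because that
   subring contains the weight idempotents 1_m.  By complementation one may take 2m <= d.  Cutting e^(N) f^(N),
   N = d - 2m, down to the weights in [m, d - m] leaves the matrix with entries
   'C(N + #|A :&: B|, m) on weight m, and Vandermonde's identity writes it as
   1_m plus integer multiples of f^(m-u) 1_u e^(m-u) for u < m. *)
Require Import Defs.
From HB Require Import structures.
From mathcomp Require Import all_boot all_order all_algebra all_fingroup.
From mathcomp Require Import zify.
Set Implicit Arguments. Unset Strict Implicit. Unset Printing Implicit Defensive.
Import Order.TTheory GRing.Theory Num.Theory.
Local Open Scope ring_scope.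

(** * Matrices indexed by sets of slots *)

Definition twos d (i : 'I_(Nd d)) : {set 'I_d} := [set k : 'I_d | bitk k i].

Lemma bits_inj d m n : (m < 2 ^ d)%N -> (n < 2 ^ d)%N ->
  (forall k, (k < d)%N -> bitk k m = bitk k n) -> m = n.
Proof.
elim: d m n => [|d IHd] m n ltm ltn eqb; first by lia.
have [eq0 eqS]: odd m = odd n /\ (m %/ 2 = n %/ 2)%N.
  split; first by have := eqb 0 isT; rewrite /bitk expn0 !divn1.
  apply: IHd => [||k ltk]; [by rewrite ltn_divLR // -expnSr..|].
  by have := eqb k.+1 ltk; rewrite /bitk expnS !divnMA.
by rewrite (divn_eq m 2) (divn_eq n 2) eqS !modn2 eq0.
Qed.

Lemma twos_bij d : bijective (@twos d).
Proof.
have E: Nd d = (2 ^ d)%N by rewrite prednK // expn_gt0.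
apply: inj_card_bij; last first.
  by rewrite card_ord E -cardsT -powersetT card_powerset cardsT card_ord.
have ltN (i : 'I_(Nd d)) : (i < 2 ^ d)%N.
  by have := ltn_ord i; move: (nat_of_ord i) => n; rewrite E.
move=> i j /setP eqij; apply/val_inj/(bits_inj (ltN i) (ltN j)) => k ltk.
by have := eqij (Ordinal ltk); rewrite !inE.
Qed.

Definition mxS d (F : {set 'I_d} -> {set 'I_d} -> rat) : 'M[rat]_(Nd d) :=
  \matrix_(i, j) F (twos i) (twos j).

Lemma mxS_eq d (F G : {set 'I_d} -> {set 'I_d} -> rat) :
  mxS F = mxS G <-> F =2 G.
Proof.
split=> [eqFG A B|eqFG]; last by apply/matrixP => i j; rewrite !mxE eqFG.
have [g _ gK] := twos_bij d.
by have /matrixP/(_ (g A) (g B)) := eqFG; rewrite !mxE !gK.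
Qed.

Lemma mxS_surj d (M : 'M[rat]_(Nd d)) : exists F, M = mxS F.
Proof.
have [g Kg _] := twos_bij d.
by exists (fun A B => M (g A) (g B)); apply/matrixP => i j; rewrite mxE !Kg.
Qed.

Lemma mxSM d (F G : {set 'I_d} -> {set 'I_d} -> rat) :
  mxS F * mxS G = mxS (fun A B => \sum_C F A C * G C B).
Proof.
apply/matrixP => i j; rewrite !mxE (reindex _ (onW_bij _ (twos_bij d))) /=.
by apply: eq_bigr => k _; rewrite !mxE.
Qed.

Lemma mxSD d (F G : {set 'I_d} -> {set 'I_d} -> rat) :
  mxS F + mxS G = mxS (fun A B => F A B + G A B).
Proof. by apply/matrixP => i j; rewrite !mxE. Qed.

Lemma mxSN d (F : {set 'I_d} -> {set 'I_d} -> rat) :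
  - mxS F = mxS (fun A B => - F A B).
Proof. by apply/matrixP => i j; rewrite !mxE. Qed.

Lemma mxSZ d a (F : {set 'I_d} -> {set 'I_d} -> rat) :
  a *: mxS F = mxS (fun A B => a * F A B).
Proof. by apply/matrixP => i j; rewrite !mxE. Qed.

Lemma mxS_sum d (I : Type) (r : seq I) (P : pred I)
    (F : I -> {set 'I_d} -> {set 'I_d} -> rat) :
  \sum_(i <- r | P i) mxS (F i) = mxS (fun A B => \sum_(i <- r | P i) F i A B).
Proof.
by apply/matrixP => i j; rewrite summxE mxE; apply: eq_bigr => k _; rewrite mxE.
Qed.

(** * Diagonal matrices that are functions of [H2] *)

Definition diagS d (g : nat -> rat) : 'M[rat]_(Nd d) :=
  mxS (fun A B : {set 'I_d} => if A == B then g #|A| else 0).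

Lemma diagS_eq d (g h : nat -> rat) :
  (forall n, (n <= d)%N -> g n = h n) -> diagS d g = diagS d h.
Proof.
move=> eqgh; apply/mxS_eq => A B; case: eqP => // _; apply: eqgh.
by rewrite -[leqRHS]card_ord max_card.
Qed.

Lemma diagS_mxS d g (F : {set 'I_d} -> {set 'I_d} -> rat) :
  diagS d g * mxS F = mxS (fun A B => g #|A| * F A B).
Proof.
rewrite mxSM; apply/mxS_eq => A B.
rewrite (bigD1 A) //= eqxx big1 ?addr0 // => C /negbTE.
by rewrite eq_sym => ->; rewrite mul0r.
Qed.

Lemma mxS_diagS d g (F : {set 'I_d} -> {set 'I_d} -> rat) :
  mxS F * diagS d g = mxS (fun A B => F A B * g #|B|).
Proof.
rewrite mxSM; apply/mxS_eq => A B.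
by rewrite (bigD1 B) //= eqxx big1 ?addr0 // => C /negbTE ->; rewrite mulr0.
Qed.

Lemma diagSM d g h : diagS d g * diagS d h = diagS d (fun n => g n * h n).
Proof.
rewrite diagS_mxS; apply/mxS_eq => A B.
by case: eqP; rewrite ?mulr0.
Qed.

Lemma diagSB d g h : diagS d g - diagS d h = diagS d (fun n => g n - h n).
Proof.
rewrite mxSN mxSD; apply/mxS_eq => A B; by case: eqP; rewrite ?subr0.
Qed.

Lemma diagSZ d a g : a *: diagS d g = diagS d (fun n => a * g n).
Proof. by rewrite mxSZ; apply/mxS_eq => A B; case: eqP; rewrite ?mulr0. Qed.

Lemma diagS_sum d (I : Type) (r : seq I) (P : pred I) (g : I -> nat -> rat) :
  \sum_(i <- r | P i) diagS d (g i) = diagS d (fun n => \sum_(i <- r | P i) g i n).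
Proof.
rewrite mxS_sum; apply/mxS_eq => A B.
by case: eqP => // _; rewrite big1.
Qed.

Lemma diagS_const d c : diagS d (fun=> c) = c%:M.
Proof.
apply/matrixP => i j; rewrite !mxE (bij_eq (twos_bij d)).
by case: eqP; rewrite ?mulr1n ?mulr0n.
Qed.

Lemma diagS1 d : diagS d (fun=> 1) = 1.
Proof. by rewrite diagS_const. Qed.

(** * Complementation: exchanging e_1 and e_2 in every slot *)

Definition flipmx d : 'M[rat]_(Nd d) :=
  mxS (fun A B : {set 'I_d} => (A == ~: B)%:R).

(** Since [flipmx] squares to 1, this is an involutive ring automorphism; it exchanges [Ee] with
    [Ff] and [H1] with [H2]. *)
Definition flip d (M : 'M[rat]_(Nd d)) := flipmx d * M * flipmx d.

Lemma flip_mxS d (F : {set 'I_d} -> {set 'I_d} -> rat) :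
  flip (mxS F) = mxS (fun A B => F (~: A) (~: B)).
Proof.
rewrite /flip !mxSM; apply/mxS_eq => A B.
rewrite (bigD1 (~: B)) //= eqxx mulr1 [X in _ + X]big1 ?addr0; last first.
  by move=> C /negbTE ->; rewrite mulr0.
rewrite (bigD1 (~: A)) //= setCK eqxx mul1r big1 ?addr0 // => C neC.
by rewrite -(inj_eq (@setC_inj _)) setCK eq_sym (negbTE neC) mul0r.
Qed.

Lemma flipmxK d : flipmx d * flipmx d = 1.
Proof.
rewrite mxSM -diagS1; apply/mxS_eq => A B.
rewrite (bigD1 (~: B)) //= eqxx setCK mulr1 big1 ?addr0; first by case: (A == B).
by move=> C /negbTE ->; rewrite mulr0.
Qed.

Lemma flip1 d : flip 1 = 1 :> 'M_(Nd d).
Proof. by rewrite /flip mulr1 flipmxK. Qed.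

Lemma flipM d (M N : 'M[rat]_(Nd d)) : flip (M * N) = flip M * flip N.
Proof.
rewrite /flip !mulrA -[_ * M * flipmx d * flipmx d]mulrA flipmxK mulr1.
by rewrite -!mulrA.
Qed.

Lemma flipK d (M : 'M[rat]_(Nd d)) : flip (flip M) = M.
Proof. by rewrite /flip !mulrA flipmxK mul1r -mulrA flipmxK mulr1. Qed.

Lemma flipD d (M N : 'M[rat]_(Nd d)) : flip (M + N) = flip M + flip N.
Proof. by rewrite /flip mulrDr mulrDl. Qed.

Lemma flipN d (M : 'M[rat]_(Nd d)) : flip (- M) = - flip M.
Proof. by rewrite /flip mulrN mulNr. Qed.

Lemma flipZ d a (M : 'M[rat]_(Nd d)) : flip (a *: M) = a *: flip M.
Proof. by rewrite /flip -scalerAr -scalerAl. Qed.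

Lemma flip_sum d (I : Type) (r : seq I) (P : pred I) (F : I -> 'M[rat]_(Nd d)) :
  flip (\sum_(i <- r | P i) F i) = \sum_(i <- r | P i) flip (F i).
Proof. by rewrite /flip mulr_sumr mulr_suml. Qed.

Lemma flip_dpow d (M : 'M[rat]_(Nd d)) m : flip (dpow M m) = dpow (flip M) m.
Proof.
rewrite /dpow flipZ; congr (_ *: _).
by elim: m => [|m IHm]; rewrite ?expr0 ?flip1 // !exprS flipM IHm.
Qed.

Lemma flip_diagS d g : flip (diagS d g) = diagS d (fun n => g (d - n)%N).
Proof.
rewrite flip_mxS; apply/mxS_eq => A B.
rewrite (inj_eq (@setC_inj _)); case: eqP => // _.
by have := cardsC A; rewrite card_ord => dE; congr g; lia.
Qed.

(** * The Lie algebra action in the subset basis *)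

Lemma rho_mxS d x : rho d x = mxS (fun A B => \sum_(k < d)
  (if A :\ k == B :\ k then x (b2o (k \in A)) (b2o (k \in B)) else 0)).
Proof.
apply/matrixP => i j; rewrite !mxE; apply: eq_bigr => k _.
rewrite !inE; congr (if _ then _ else _).
apply/forallP/eqP => [eqij|/setP eqij l].
  apply/setP => l; rewrite !inE.
  by have := eqij l; case: (l == k) => //= /eqP.
by apply/implyP => nelk; have := eqij l; rewrite !inE nelk /= => ->.
Qed.

Lemma flip_rho d (x y : 'M[rat]_2) :
  (forall b c, x (b2o b) (b2o c) = y (b2o (~~ b)) (b2o (~~ c))) ->
  flip (rho d x) = rho d y.
Proof.
move=> eqxy; rewrite !rho_mxS flip_mxS; apply/mxS_eq => A B.
apply: eq_bigr => k _; rewrite eqxy !inE !negbK; congr (if _ then _ else _).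
apply/eqP/eqP => /setP eqAB; apply/setP => l; have := eqAB l; rewrite !inE.
  by case: (l == k) => //= /(congr1 negb); rewrite !negbK.
by case: (l == k) => //= ->.
Qed.

Lemma flip_Ee d : flip (Ee d) = Ff d.
Proof. by apply: flip_rho => [] [] []; rewrite !mxE. Qed.

Lemma flip_Ff d : flip (Ff d) = Ee d.
Proof. by rewrite -flip_Ee flipK. Qed.

Lemma flip_H2 d : flip (H2 d) = H1 d.
Proof. by apply: flip_rho => [] [] []; rewrite !mxE. Qed.

Lemma H2E d : H2 d = diagS d (fun n => n%:R).
Proof.
rewrite /H2 rho_mxS; apply/mxS_eq => A B.
case: eqP => [<-|neAB].
  rewrite -sum1_card natr_sum [RHS]big_mkcond /=.
  apply: eq_bigr => k _; rewrite eqxx mxE.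
  by case: (k \in A).
(* Distinct sets that agree off [k] differ at [k], and the matrix unit has no off-diagonal entry. *)
rewrite big1 // => k _; case: eqP => // /setP eqAB; rewrite mxE.
case kA: (k \in A); case kB: (k \in B) => //; case: neAB; apply/setP => l.
by have := eqAB l; rewrite !inE; case: eqP => //= -> _; rewrite kA kB.
Qed.

(** * Divided powers as inclusion matrices *)

Definition upS d m : 'M[rat]_(Nd d) :=
  mxS (fun A B : {set 'I_d} => ((A \subset B) && (#|B :\: A| == m))%:R).

Lemma EeE d : Ee d = upS d 1.
Proof.
rewrite /Ee rho_mxS; apply/mxS_eq => A B.
(* Slot [k] contributes exactly when [B] arises from [A] by adding [k]; a pair admits at most one
   such slot. *)
transitivity (\sum_(k < d) ((A \subset B) && (B :\: A == [set k]))%:R : rat).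
  apply: eq_bigr => k _; rewrite mxE.
  have -> : (A \subset B) && (B :\: A == [set k]) =
    [&& A :\ k == B :\ k, k \notin A & k \in B].
    apply/andP/and3P => [[sAB /eqP/setP eqk]|[/eqP/setP eqk kA kB]].
      have := eqk k; rewrite !inE eqxx => /andP[-> ->]; split=> //.
      apply/eqP/setP => l; have := eqk l; rewrite !inE; have := subsetP sAB l.
      by case: (l == k) => //=; case: (l \in A) => //= ->.
    split; first apply/subsetP => l lA.
      have := eqk l; rewrite !inE lA; case: eqP => [-> //|_] /= <- //.
    apply/eqP/setP => l; have := eqk l; rewrite !inE.
    case: eqP => [-> _|_ /= -> ]; first by rewrite kA kB.
    by rewrite andNb.
  by case: eqP => //= _; do 2 case: (k \in _).
case: (A \subset B); last by rewrite big1.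
case: (@cards1P _ (B :\: A)) => [[k ->]|nex] /=.
  rewrite (bigD1 k) //= eqxx big1 ?addr0 // => l nelk.
  by rewrite (inj_eq (@set1_inj _)) eq_sym (negbTE nelk).
rewrite big1 // => k _; case: eqP => // eqk; by case: nex; exists k.
Qed.

(** [C] corresponds to the subset [C :\: A] of [B :\: A], with inverse [D] to [A :|: D]. *)
Lemma card_between (T : finType) (A B : {set T}) n : A \subset B ->
  #|[set C : {set T} | [&& A \subset C, C \subset B & #|C :\: A| == n]]|
    = 'C(#|B :\: A|, n).
Proof.
move=> sAB; rewrite -cards_draws.
rewrite -(card_in_imset (f := fun C : {set T} => C :\: A)); last first.
  move=> C D; rewrite !inE => /andP[sAC _] /andP[sAD _] eqCD.
  by rewrite -(setID C A) -(setID D A) eqCD (setIidPr sAC) (setIidPr sAD).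
apply: eq_card => D; rewrite !inE; apply/imsetP/idP.
  by case=> C; rewrite inE => /and3P[sAC sCB ?] ->; rewrite setSD.
rewrite subsetD => /andP[/andP[sDB dDA] cD]; exists (A :|: D).
  by rewrite inE subsetUl subUset sAB sDB setDUl setDv set0U (setDidPl dDA).
by rewrite setDUl setDv set0U (setDidPl dDA).
Qed.

Lemma sum_bool_card (R : pzSemiRingType) (T : finType) (P : pred T) :
  \sum_x (P x)%:R = #|[set x | P x]|%:R :> R.
Proof.
rewrite -sum1_card natr_sum [RHS]big_mkcond /=.
by apply: eq_bigr => x _; rewrite inE; case: (P x).
Qed.

(** An intermediate set adds to [A] one of the m + 1 elements of [B :\: A], whence the factor;
    iterating it produces m!. *)
Lemma upS1M d m : upS d 1 * upS d m = m.+1%:R *: upS d m.+1.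
Proof.
rewrite mxSM mxSZ; apply/mxS_eq => A B.
under eq_bigr do rewrite -natrM mulnb.
rewrite sum_bool_card; case: (boolP (A \subset B)) => [sAB|nsAB] /=; last first.
  rewrite mulr0 (_ : [set _ | _] = set0) ?cards0 //.
  apply/setP => C; rewrite !inE; apply/negP => /andP[/andP[sAC _] /andP[sCB _]].
  by case/negP: nsAB; apply: subset_trans sCB.
have ceq (C : {set _}) : A \subset C -> C \subset B ->
    #|B :\: A| = (#|C :\: A| + #|B :\: C|)%N.
  move=> sAC sCB; rewrite !cardsDS //.
  by have := subset_leq_card sAC; have := subset_leq_card sCB; lia.
case: eqP => cBA; last first.
  rewrite mulr0 (_ : [set _ | _] = set0) ?cards0 //.
  apply/setP => C; rewrite !inE.
  apply/negP => /andP[/andP[sAC /eqP c1] /andP[sCB /eqP c2]].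
  by case: cBA; rewrite (ceq C) // c1 c2.
rewrite mulr1 -[in RHS](bin1 m.+1) -cBA -card_between //; congr (_%:R).
apply: eq_card => C; rewrite !inE; apply/idP/idP.
  by case/andP=> /andP[-> ->] /andP[->].
case/and3P=> sAC sCB /eqP c1; rewrite sAC sCB c1 eqxx /=.
by have := ceq C sAC sCB; rewrite c1 cBA add1n => -[<-].
Qed.

Lemma dpow_Ee d m : dpow (Ee d) m = upS d m.
Proof.
rewrite /dpow; suff -> : Ee d ^+ m = m`!%:R *: upS d m.
  by rewrite scalerA mulVf ?scale1r // pnatr_eq0 -lt0n fact_gt0.
elim: m => [|m IHm].
  rewrite expr0 fact0 scale1r -diagS1; apply/mxS_eq => A B.
  by rewrite cards_eq0 setD_eq0 -eqEsubset; case: eqP.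
by rewrite exprS IHm EeE -scalerAr upS1M scalerA -natrM mulnC -factS.
Qed.

Definition downS d m : 'M[rat]_(Nd d) :=
  mxS (fun A B : {set 'I_d} => ((B \subset A) && (#|A :\: B| == m))%:R).

Lemma flip_upS d m : flip (upS d m) = downS d m.
Proof.
rewrite flip_mxS; apply/mxS_eq => A B.
by rewrite setCS !setDE setCK setIC.
Qed.

Lemma flip_downS d m : flip (downS d m) = upS d m.
Proof. by rewrite -flip_upS flipK. Qed.

Lemma dpow_Ff d m : dpow (Ff d) m = downS d m.
Proof. by rewrite -flip_Ee -flip_dpow dpow_Ee flip_upS. Qed.

(** * Products of f^(a), a function of [H2] and e^(c); binomials in [H1] and [H2] *)

(** The guard says that removing [a] elements from [A] and [c] from [B] is possible and leaves equal
    sizes; its inequalities keep the truncated subtractions exact. *)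
Definition du_entry d (a c : nat) (g : nat -> rat) (A B : {set 'I_d}) : rat :=
  if [&& a <= #|A|, c <= #|B| & #|A| - a == #|B| - c]%N
  then 'C(#|A :&: B|, #|A| - a)%:R * g (#|A| - a)%N else 0.

(* The intermediate states are the subsets [C] of [A :&: B] of size [#|A| - a]. *)
Lemma down_diag_up d a c g :
  downS d a * diagS d g * upS d c = mxS (du_entry a c g).
Proof.
rewrite mxS_diagS mxSM; apply/mxS_eq => A B; rewrite /du_entry.
transitivity (\sum_(C : {set 'I_d})
    (if [&& a <= #|A|, c <= #|B| & #|A| - a == #|B| - c]%N
     then ((C \subset A :&: B) && (#|C| == #|A| - a)%N)%:R * g (#|A| - a)%N else 0)).
  apply: eq_bigr => C _; rewrite subsetI.
  case: (boolP (C \subset A)) => [sCA|_]; last by rewrite !mul0r if_same.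
  case: (boolP (C \subset B)) => [sCB|_]; last by rewrite mulr0 mul0r if_same.
  rewrite !cardsDS //=.
  have := subset_leq_card sCA; have := subset_leq_card sCB => leB leA.
  have [eA|nA] := eqVneq (#|A| - #|C|)%N a; last first.
    rewrite !mul0r; case: and3P => // -[h1 h2 h3].
    case: eqP => [eC|]; last by rewrite mul0r.
    by case/eqP: nA; rewrite eC subKn.
  have [eB|nB] := eqVneq (#|B| - #|C|)%N c; last first.
    rewrite mulr0; case: and3P => // -[h1 h2 /eqP h3].
    case: eqP => [eC|]; last by rewrite mul0r.
    by case/eqP: nB; rewrite eC h3 subKn.
  have -> : [&& a <= #|A|, c <= #|B| & #|A| - a == #|B| - c]%N by lia.
  have -> : (#|A| - a = #|C|)%N by lia.
  by rewrite eqxx mulr1.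
case: ifP => _; last by rewrite big1.
by rewrite -mulr_suml sum_bool_card cards_draws.
Qed.

Lemma prod_subn (n m : nat) : \prod_(i < m) (n%:R - i%:R) = (n ^_ m)%:R :> rat.
Proof.
elim: m => [|m IHm]; first by rewrite big_ord0 ffactn0.
rewrite big_ord_recr /= IHm ffactnSr natrM.
have [lemn|ltnm] := leqP m n; first by rewrite natrB.
(* For [n < m] the falling factorial is already 0, so the truncated [n - m] does no harm. *)
by rewrite ffact_small // !mul0r.
Qed.

Lemma binomT_H2 d b : binomT (H2 d) b = diagS d (fun n => 'C(n, b)%:R).
Proof.
rewrite /binomT H2E.
have -> : \prod_(i < b) (diagS d (fun n => n%:R) - i%:R) =
          diagS d (fun n => (n ^_ b)%:R).
  rewrite (eq_bigr (fun i : 'I_b => diagS d (fun n => n%:R - i%:R))); last first.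
    move=> i _; rewrite -diagSB diagS_const; congr (_ - _).
    by rewrite (rmorph_nat (@scalar_mx rat (Nd d))).
  elim: b => [|b IHb].
    by rewrite big_ord0 -diagS1; apply: diagS_eq => n _; rewrite ffactn0.
  rewrite big_ord_recr /= IHb diagSM; apply: diagS_eq => n _.
  by rewrite -!prod_subn big_ord_recr.
rewrite diagSZ; apply: diagS_eq => n _.
by rewrite -bin_ffact natrM mulrC mulfK // pnatr_eq0 -lt0n fact_gt0.
Qed.

Lemma binomT_H1 d b : binomT (H1 d) b = flip (binomT (H2 d) b).
Proof.
rewrite /binomT flipZ (big_morph _ (@flipM d) (flip1 d)); congr (_ *: _).
apply: eq_bigr => i _; rewrite flipD flip_H2 flipN; congr (_ - _).
elim: (nat_of_ord i) => [|n IHn]; first by rewrite /flip mulr0 mul0r.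
by rewrite -natr1 flipD -IHn flip1.
Qed.

(** * Closure properties of the subring generated by divided powers *)

Lemma gen_flip d (M : 'M[rat]_(Nd d)) : gen_dp M -> gen_dp (flip M).
Proof.
elim=> [|m|m|A B _ gA _ gB|A _ gA|A B _ gA _ gB].
- by rewrite flip1; apply: gen_one.
- by rewrite flip_dpow flip_Ee; apply: gen_f.
- by rewrite flip_dpow flip_Ff; apply: gen_e.
- by rewrite flipD; apply: gen_add.
- by rewrite flipN; apply: gen_opp.
by rewrite flipM; apply: gen_mul.
Qed.

Lemma gen_zero d : gen_dp (0 : 'M[rat]_(Nd d)).
Proof.
by rewrite -[0](subrr 1); apply: gen_add; [|apply: gen_opp]; apply: gen_one.
Qed.

Lemma gen_sum d (I : finType) (P : pred I) (F : I -> 'M[rat]_(Nd d)) :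
  (forall i, P i -> gen_dp (F i)) -> gen_dp (\sum_(i | P i) F i).
Proof. by move=> gF; apply: big_ind => //; [apply: gen_zero|apply: gen_add]. Qed.

Lemma gen_natZ d n (M : 'M[rat]_(Nd d)) : gen_dp M -> gen_dp (n%:R *: M).
Proof.
move=> gM; elim: n => [|n IHn]; first by rewrite scale0r; apply: gen_zero.
by rewrite -natr1 scalerDl scale1r; apply: gen_add.
Qed.

Lemma gen_intZ d (z : int) (M : 'M[rat]_(Nd d)) :
  gen_dp M -> gen_dp (z%:~R *: M).
Proof.
move=> gM; case: z => n; first exact: gen_natZ.
by rewrite NegzE mulrNz scaleNr; apply/gen_opp/gen_natZ.
Qed.

Lemma gen_upS d m : gen_dp (upS d m).
Proof. by rewrite -dpow_Ee; apply: gen_e. Qed.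

Lemma gen_downS d m : gen_dp (downS d m).
Proof. by rewrite -dpow_Ff; apply: gen_f. Qed.

(** * Weight idempotents lie in the subring *)

Definition wt d m : 'M[rat]_(Nd d) := diagS d (fun n => (n == m)%:R).

Lemma flip_wt d m : (m <= d)%N -> flip (wt d m) = wt d (d - m)%N.
Proof.
move=> lemd; rewrite flip_diagS; apply: diagS_eq => n lend.
by congr (_%:R); lia.
Qed.

Lemma sum_eq_lt (n m : nat) : \sum_(u < m) (n == u)%:R = (n < m)%N%:R :> rat.
Proof.
elim: m => [|m IHm]; first by rewrite big_ord0.
rewrite big_ord_recr /= IHm -natrD; congr (_%:R).
by case: ltngtP; lia.
Qed.

Definition window d m : 'M[rat]_(Nd d) := diagS d (fun n => (m <= n <= d - m)%N%:R).

(** The weights removed are those below m and their mirror images, disjoint because 2m <= d. This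
    form lets an induction on m put the window in the subring. *)
Lemma windowE d m : (2 * m <= d)%N ->
  window d m = 1 - \sum_(u < m) (wt d u + flip (wt d u)).
Proof.
move=> le2md; rewrite big_split /= -diagS1.
rewrite (eq_bigr (fun u : 'I_m => diagS d (fun n => (d - n == u)%N%:R))
  (F1 := fun u => flip _));
  last by move=> u _; rewrite flip_diagS.
rewrite !diagS_sum opprD addrA !diagSB; apply: diagS_eq => n lend.
rewrite !sum_eq_lt; case: (ltnP n m) => h1; case: (ltnP (d - n) m) => h2 /=.
- lia.
- by [].
- by have -> : (n <= d - m)%N = false by lia.
- by have -> : (n <= d - m)%N by lia.
Qed.

(** The window has width N = d - 2m, so the only weight that [downS d N] keeps inside it is m, moved
    to d - m; [upS d N] brings it back to m. The intermediate sets contain [A :|: B], and their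
    complements are the m-subsets of [~: (A :|: B)], which has N + #|A :&: B| elements. *)
Lemma up_window_down d m : (2 * m <= d)%N ->
  upS d (d - 2 * m)%N * window d m * downS d (d - 2 * m)%N * window d m =
  mxS (fun A B => if (#|A| == m) && (#|B| == m)
                  then 'C(d - (2 * m) + #|A :&: B|, m)%:R else 0).
Proof.
move=> le2md; set N := (d - 2 * m)%N.
(* Complementation turns e g f into f g e, whose entries are known. *)
have -> : upS d N * window d m * downS d N =
          flip (downS d N * flip (window d m) * upS d N).
  by rewrite 2!flipM flipK flip_upS flip_downS.
rewrite flip_diagS down_diag_up flip_mxS mxS_diagS {}/N.
apply/mxS_eq => A B; rewrite /du_entry.
have cA := cardsC A; have cB := cardsC B; rewrite card_ord in cA cB.
have cAB := cardsC (A :|: B); rewrite card_ord cardsU setCU in cAB.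
have leI : (#|A :&: B| <= #|A|)%N by rewrite subset_leq_card ?subsetIl.
case: and3P => [[h1 h2 /eqP h3]|h]; last first.
  rewrite mul0r; case: andP => // -[/eqP eA /eqP eB]; case: h; split; lia.
have [/andP[/eqP eA /eqP eB]|h] := boolP ((#|A| == m) && (#|B| == m)).
  have -> : (m <= d - (#|~: A| - (d - 2 * m)) <= d - m)%N by lia.
  have -> : (m <= #|B| <= d - m)%N by lia.
  by rewrite !mulr1; congr ('C(_, _)%:R); lia.
have [h4|] := boolP (m <= #|B| <= d - m)%N; last by rewrite mulr0.
suff -> : (m <= d - (#|~: A| - (d - 2 * m)) <= d - m)%N = false.
  by rewrite mulr0 mul0r.
apply/negP => /andP[h5 h6]; move: h4 => /andP[h4 h7].
have eAB : #|A| = #|B| by lia.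
have h8 : (m <= #|~: A| - (d - 2 * m))%N by clear -h6 le2md; lia.
have leA : (#|A| <= m)%N by clear -h8 le2md cA h1; lia.
by case/negP: h; rewrite -eAB andbb eqn_leq leA eAB h4.
Qed.

(* Vandermonde's identity, applied to the entries: the term [u = m] of the
   expansion of 'C(d - 2m + #|A :&: B|, m) is the weight idempotent itself. *)
Lemma wtE d m : (2 * m <= d)%N ->
  wt d m = upS d (d - 2 * m)%N * window d m * downS d (d - 2 * m)%N * window d m
   - \sum_(u < m) 'C(d - (2 * m), m - u)%:R *:
       (downS d (m - u)%N * wt d u * upS d (m - u)%N).
Proof.
move=> le2md; rewrite up_window_down //.
under eq_bigr do rewrite down_diag_up mxSZ.
rewrite mxS_sum mxSN mxSD; apply/mxS_eq => A B.
case: andP => [[/eqP eA /eqP eB]|h]; last first.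
  rewrite big1 => [|u _].
    rewrite subr0; case: eqP => // eAB; case: eqP => // eA.
    by case: h; rewrite -eAB eA.
  rewrite /du_entry; case: and3P => [[h1 h2 /eqP h3]|]; last by rewrite mulr0.
  case: eqP => [eu|]; last by rewrite !mulr0.
  by case: h; split; apply/eqP; have := ltn_ord u; lia.
rewrite addnC -binomial.Vandermonde big_ord_recr /= subnn bin0 muln1.
rewrite natrD natr_sum addrAC -sumrB big1 => [|u _].
  (* For sets of size m, 'C(#|A :&: B|, m) is 1 if they are equal and 0 otherwise. *)
  rewrite add0r eA eqxx; case: eqP => [<-|neAB].
    by rewrite setIid eA binn.
  rewrite bin_small // -eA proper_card // properE subsetIl /=.
  apply/negP => sAI; case: neAB; apply/eqP; rewrite eqEcard eA eB leqnn andbT.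
  by apply: subset_trans sAI (subsetIr _ _).
have ltum := ltn_ord u; rewrite /du_entry eA eB leq_subr eqxx /=.
by rewrite subKn ?(ltnW ltum) // eqxx mulr1 -natrM mulnC subrr.
Qed.

(** Strong induction on the lower half of the weights: besides divided powers, [wtE] and [windowE]
    involve only smaller weights and their mirror images. The upper half follows by
    complementation. *)
Lemma gen_wt d m : (m <= d)%N -> gen_dp (wt d m).
Proof.
suff gen_half n : (2 * n <= d)%N -> gen_dp (wt d n).
  move=> lemd; have [|lt] := leqP (2 * m) d; first exact: gen_half.
  rewrite -[m](subKn lemd) -flip_wt ?leq_subr //.
  by apply/gen_flip/gen_half; lia.
elim/ltn_ind: n => n IHn le2nd.
have gen_low (u : 'I_n) : gen_dp (wt d u) by apply: IHn; have := ltn_ord u; lia.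
have gen_window : gen_dp (window d n).
  rewrite windowE //; apply: gen_add; first exact: gen_one.
  by apply/gen_opp/gen_sum => u _; apply: gen_add => //; apply: gen_flip.
rewrite wtE //; apply: gen_add.
  do !apply: gen_mul => //; [exact: gen_upS|exact: gen_downS].
apply/gen_opp/gen_sum => u _; apply: gen_natZ.
by do !apply: gen_mul => //; [exact: gen_downS|exact: gen_upS].
Qed.

(** Integer combinations of weight idempotents; the case needed is binom(H_2, b), where [k n] is
    'C(n, b). *)
Lemma gen_diagS d (k : nat -> nat) : gen_dp (diagS d (fun n => (k n)%:R)).
Proof.
have -> : diagS d (fun n => (k n)%:R) = \sum_(m < d.+1) (k m)%:R *: wt d m.
  under eq_bigr do rewrite diagSZ.
  rewrite diagS_sum; apply: diagS_eq => n lend.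
  rewrite (bigD1 (inord n)) //= inordK // eqxx mulr1 big1 ?addr0 // => i nei.
  case: eqP => [en|]; last by rewrite mulr0.
  by case/eqP: nei; apply: val_inj; rewrite /= inordK.
by apply: gen_sum => m _; apply/gen_natZ/gen_wt; rewrite -ltnS.
Qed.

(** * The integral Schur algebra as invariant integer matrices *)

Lemma placeP_mxS d (s : 'S_d) : placeP s = mxS (fun A B => (A == s @^-1: B)%:R).
Proof.
apply/matrixP => i j; rewrite !mxE.
suff -> : [forall k : 'I_d, bitk k i == bitk (s k) j] = (twos i == s @^-1: twos j).
  by case: eqP.
apply/forallP/eqP => [eqb|/setP eqb k]; last by have := eqb k; rewrite !inE => ->.
by apply/setP => k; rewrite !inE; apply/eqP.
Qed.

Lemma preim_perm_inj d (s : 'S_d) : injective (fun A : {set 'I_d} => s @^-1: A).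
Proof.
move=> A B /setP eqAB; apply/setP => k.
by have := eqAB (s^-1%g k); rewrite !inE permKV.
Qed.

Lemma preim_permK d (s : 'S_d) (A : {set 'I_d}) : s @^-1: (s^-1%g @^-1: A) = A.
Proof. by apply/setP => k; rewrite !inE permK. Qed.

(** Conjugation by a permutation matrix relabels both indices, so commuting with all of them means
    being constant on the orbits of pairs of subsets. *)
Lemma SZ_mxS d (F : {set 'I_d} -> {set 'I_d} -> rat) :
  SZ (mxS F) <-> (forall A B, F A B \is a Num.int) /\
    (forall (s : 'S_d) (A B : {set 'I_d}), F (s @^-1: A) (s @^-1: B) = F A B).
Proof.
have int_iff : (forall i j, mxS F i j \is a Num.int) <->
    (forall A B, F A B \is a Num.int).
  split=> [intF A B|intF i j]; last by rewrite mxE.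
  have [g _ gK] := twos_bij d.
  by have := intF (g A) (g B); rewrite mxE !gK.
have comm_iff (s : 'S_d) : mxS F * placeP s = placeP s * mxS F <->
    (forall A B : {set 'I_d}, F (s @^-1: A) (s @^-1: B) = F A B).
  have l (A B : {set 'I_d}) :
      \sum_(C : {set 'I_d}) F A C * (C == s @^-1: B)%:R = F A (s @^-1: B).
    rewrite (bigD1 (s @^-1: B)) //= eqxx mulr1 big1 ?addr0 //.
    by move=> C /negbTE ->; rewrite mulr0.
  have r (A B : {set 'I_d}) :
      \sum_(C : {set 'I_d}) (s @^-1: A == s @^-1: C)%:R * F C B = F A B.
    rewrite (bigD1 A) //= eqxx mul1r big1 ?addr0 // => C neCA.
    by rewrite (inj_eq (@preim_perm_inj d s)) eq_sym (negbTE neCA) mul0r.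
  rewrite placeP_mxS !mxSM mxS_eq; split=> eqF A B.
    by rewrite -(r A B) -l eqF.
  by rewrite l -(preim_permK s A) eqF r.
by rewrite /SZ; split=> -[h1 h2]; split; [apply/int_iff|move=> s; apply/comm_iff
  |apply/int_iff|move=> s; apply/comm_iff].
Qed.

Lemma SZ_one d : SZ (1 : 'M[rat]_(Nd d)).
Proof.
by split=> [i j|s]; [rewrite mxE; case: eqP|rewrite mul1r mulr1].
Qed.

Lemma SZ_opp d (M : 'M[rat]_(Nd d)) : SZ M -> SZ (- M).
Proof.
by case=> intM comM; split=> [i j|s]; rewrite ?mxE ?rpredN // mulrN mulNr comM.
Qed.

Lemma SZ_add d (M N : 'M[rat]_(Nd d)) : SZ M -> SZ N -> SZ (M + N).
Proof.
case=> intM comM [intN comN].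
by split=> [i j|s]; rewrite ?mxE ?rpredD // mulrDl mulrDr comM comN.
Qed.

Lemma SZ_mul d (M N : 'M[rat]_(Nd d)) : SZ M -> SZ N -> SZ (M * N).
Proof.
case=> intM comM [intN comN]; split=> [i j|s].
  by rewrite mxE rpred_sum // => k _; rewrite rpredM.
by rewrite -mulrA comN mulrA comM mulrA.
Qed.

Lemma preimset_perm_card d (s : 'S_d) (A : {set 'I_d}) : #|s @^-1: A| = #|A|.
Proof. by apply: card_preimset; apply: perm_inj. Qed.

Lemma preimset_perm_sub d (s : 'S_d) (A B : {set 'I_d}) :
  (s @^-1: A \subset s @^-1: B) = (A \subset B).
Proof.
by rewrite -!setD_eq0 -preimsetD -!cards_eq0 preimset_perm_card.
Qed.

Lemma SZ_upS d m : SZ (upS d m).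
Proof.
apply/SZ_mxS; split=> [A B|s A B]; first exact: natr_int.
by rewrite preimset_perm_sub -preimsetD preimset_perm_card.
Qed.

Lemma SZ_downS d m : SZ (downS d m).
Proof.
apply/SZ_mxS; split=> [A B|s A B]; first exact: natr_int.
by rewrite preimset_perm_sub -preimsetD preimset_perm_card.
Qed.

Lemma gen_SZ d (M : 'M[rat]_(Nd d)) : gen_dp M -> SZ M.
Proof.
elim=> [|m|m|A B _ gA _ gB|A _ gA|A B _ gA _ gB].
- exact: SZ_one.
- by rewrite dpow_Ee; apply: SZ_upS.
- by rewrite dpow_Ff; apply: SZ_downS.
- exact: SZ_add.
- exact: SZ_opp.
exact: SZ_mul.
Qed.

(** * Orbits of pairs of subsets *)

(** Write a pair as the word of its membership bits over the slots. Two words with the same letter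
    counts differ by a permutation; the count of the fourth letter follows from the other three and
    d. *)
Lemma same_cards_perm d (A B A' B' : {set 'I_d}) :
  #|A :\: B| = #|A' :\: B'| -> #|A :&: B| = #|A' :&: B'| ->
  #|B :\: A| = #|B' :\: A'| ->
  exists s : 'S_d, A = s @^-1: A' /\ B = s @^-1: B'.
Proof.
move=> eAB eI eBA.
pose t (X Y : {set 'I_d}) := [tuple (k \in X, k \in Y) | k < d].
have cnt (X Y : {set 'I_d}) p : count_mem p (t X Y) = #|[set k | (k \in X, k \in Y) == p]|.
  rewrite /= count_map cardE -size_filter enumT /enum_mem; congr size.
  by apply: eq_filter => k; apply: esym (in_set _ _).
have cU (X Y : {set 'I_d}) :
    (#|~: (X :|: Y)| = d - (#|X :\: Y| + #|X :&: Y| + #|Y :\: X|))%N.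
  have := cardsC (X :|: Y); rewrite card_ord cardsU.
  have := cardsID Y X; have := cardsID X Y; rewrite [Y :&: X]setIC.
  lia.
have : perm_eq (t A B) (t A' B').
  apply/allP => -[b c] _ /=; apply/eqP; rewrite !cnt.
  have cE (X Y : {set 'I_d}) : #|[set k | (k \in X, k \in Y) == (b, c)]| =
     if b then (if c then #|X :&: Y| else #|X :\: Y|)
     else (if c then #|Y :\: X| else #|~: (X :|: Y)|).
    by case: b; case: c; apply: eq_card => k; rewrite !inE xpair_eqE;
      case: (k \in X); case: (k \in Y).
  by rewrite !cE eAB eI eBA !cU eAB eI eBA.
case/tuple_permP => s eqs; exists s.
have eqk k : (k \in A, k \in B) = (s k \in A', s k \in B').
  have -> : (k \in A, k \in B) = tnth (t A B) k by rewrite tnth_mktuple.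
  have -> : t A B = [tuple tnth (t A' B') (s i) | i < d] by apply: val_inj.
  by rewrite !tnth_mktuple.
by split; apply/setP => k; rewrite inE; case: (eqk k).
Qed.

(** The label of an orbit; [inord] loses nothing, as all three sizes are at most d. *)
Definition typ d (A B : {set 'I_d}) : 'I_d.+1 * 'I_d.+1 * 'I_d.+1 :=
  (inord #|A :\: B|, inord #|A :&: B|, inord #|B :\: A|).

Lemma card_leq_ord d (A : {set 'I_d}) : (#|A| < d.+1)%N.
Proof. by rewrite ltnS -[leqRHS]card_ord max_card. Qed.

Lemma triple_ok_typ d (A B : {set 'I_d}) : triple_ok (typ A B).
Proof.
rewrite /triple_ok /= !inordK ?card_leq_ord //.
have := card_leq_ord (A :|: B); rewrite cardsU ltnS.
move: (cardsID B A) (cardsID A B); rewrite [B :&: A]setIC.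
move: #|A :&: B| #|A :\: B| #|B :\: A| #|A| #|B| => i x y m n.
lia.
Qed.

Lemma card_ord_interval d m n : (m <= n <= d)%N ->
  #|[set k : 'I_d | (m <= k < n)%N]| = (n - m)%N.
Proof.
case/andP=> lemn lend.
have <- : (\sum_(m <= k < n) 1 = n - m)%N by rewrite sum_nat_const_nat muln1.
rewrite (big_nat_widen _ _ _ _ _ lend) (big_nat_widenl _ _ _ _ _ (leq0n m)) big_mkord.
by rewrite -sum1_card; apply: eq_bigl => k; rewrite inE andbC.
Qed.

Lemma typ_surj d (t : 'I_d.+1 * 'I_d.+1 * 'I_d.+1) :
  triple_ok t -> exists A B : {set 'I_d}, typ A B = t.
Proof.
case: t => [[a b] c]; rewrite /triple_ok /= => ok.
pose I m n := [set k : 'I_d | (m <= k < n)%N].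
(* Two overlapping intervals of slots, which fit because a + b + c <= d. *)
exists (I 0 (a + b))%N, (I a (a + b + c))%N; rewrite /typ.
have -> : I 0%N (a + b)%N :\: I a (a + b + c)%N = I 0%N a.
  by apply/setP => k; rewrite !inE; lia.
have -> : I 0%N (a + b)%N :&: I a (a + b + c)%N = I a (a + b)%N.
  by apply/setP => k; rewrite !inE; lia.
have -> : I a (a + b + c)%N :\: I 0%N (a + b)%N = I (a + b)%N (a + b + c)%N.
  by apply/setP => k; rewrite !inE; lia.
rewrite !card_ord_interval; [|lia|lia|lia].
by rewrite subn0 !addKn !inord_val.
Qed.

Lemma SZ_typ d (M : 'M[rat]_(Nd d)) : SZ M ->
  exists g : 'I_d.+1 * 'I_d.+1 * 'I_d.+1 -> int,
    M = mxS (fun A B => (g (typ A B))%:~R).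
Proof.
have [F ->] := mxS_surj M; case/SZ_mxS => intF invF.
(* The value is read off at any pair of type [t], by invariance; the default 0 is taken only when no
   pair has type [t]. *)
exists (fun t => if [pick p | typ p.1 p.2 == t] is Some p then numq (F p.1 p.2) else 0).
apply/mxS_eq => A B; case: pickP => [[A' B'] /= /eqP eqt|/(_ (A, B))]; last by rewrite eqxx.
rewrite numqK //; case: eqt => /(congr1 val) + /(congr1 val) + /(congr1 val).
rewrite /= !inordK ?card_leq_ord // => e1 e2 e3.
by have [s [-> ->]] := same_cards_perm e1 e2 e3; rewrite invF.
Qed.

(** * Unitriangular integer systems and the coefficients of the products *)

Section Unitriangular.

Variables (I : finType) (sel : pred I) (K : I -> I -> int) (mu : I -> nat).
Hypothesis K1 : forall t, sel t -> K t t = 1.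
Hypothesis Klt : forall s t, sel s -> sel t -> s != t -> K s t != 0 -> (mu t < mu s)%N.

(** Elimination from the highest rank down: subtracting [h s] times row [s] for all [s] of rank n
    clears rank n and otherwise alters only lower ranks. Unit diagonal entries avoid division. *)
Lemma unitriangular_span (g : I -> int) :
  exists c : I -> int, forall t, sel t -> g t = \sum_(s | sel s) c s * K s t.
Proof.
suff span n (h : I -> int) : (forall t, sel t -> (n <= mu t)%N -> h t = 0) ->
    exists c : I -> int, forall t, sel t -> h t = \sum_(s | sel s) c s * K s t.
  apply: (span (\max_t mu t).+1) => t _.
  by rewrite ltnNge leq_bigmax.
elim: n h => [|n IHn] h h0.
  exists (fun=> 0) => t selt; rewrite h0 // big1 // => s _; exact: mul0r.
pose top s : int := if mu s == n then h s else 0.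
have [t selt lent|c cE] := IHn (fun t => h t - \sum_(s | sel s) top s * K s t).
  rewrite (bigD1 t) //= K1 // mulr1 [X in _ - (_ + X)]big1 ?addr0 => [|s /andP[sels nest]].
    rewrite /top; case: eqP => [_|ne]; first exact: subrr.
    by rewrite subr0 h0 //; lia.
  rewrite /top; case: eqP => [eqs|_]; last exact: mul0r.
  have [->|/Klt lt] := eqVneq (K s t) 0; first exact: mulr0.
  by have := lt sels selt nest; lia.
exists (fun s => c s + top s) => t selt.
under eq_bigr do rewrite mulrDl.
by rewrite big_split /= -cE // subrK.
Qed.

(** Downward induction on the rank: apart from [c t], the equation at [t] involves only coefficients
    of higher rank, already known to vanish. *)
Lemma unitriangular_free (c : I -> int) :
  (forall t, sel t -> \sum_(s | sel s) c s * K s t = 0) ->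
  forall t, sel t -> c t = 0.
Proof.
move=> c0 t selt; pose N := \max_s mu s.
have [n] := ubnP (N - mu t); elim: n t selt => // n IHn t selt ltn.
have := c0 t selt; rewrite (bigD1 t) //= K1 // mulr1 big1 ?addr0 // => s /andP[sels nest].
have [->|/Klt lt] := eqVneq (K s t) 0; first exact: mulr0.
rewrite IHn ?mul0r //; have := lt sels selt nest.
by have := leq_bigmax (F := mu) s; rewrite -/N; lia.
Qed.

End Unitriangular.

(* Coefficient of the orbit sum of type [t] in [f^(a) binom(H2, b) e^(c)], where
   [s = (a, b, c)] and [t] lists the sizes of [A :\: B], [A :&: B], [B :\: A]. *)
Definition orbit_coef d (s t : 'I_d.+1 * 'I_d.+1 * 'I_d.+1) : int :=
  if [&& s.1.1 <= t.1.1 + t.1.2, s.2 <= t.2 + t.1.2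
       & t.1.1 + t.1.2 - s.1.1 == t.2 + t.1.2 - s.2]%N
  then ('C(t.1.2, t.1.1 + t.1.2 - s.1.1) * 'C(t.1.1 + t.1.2 - s.1.1, s.1.2))%N%:Z
  else 0.

(** Encodes the lexicographic order, first by a, then by decreasing b; the factor d + 1 dominates
    since d - b <= d. *)
Definition orbit_rank d (t : 'I_d.+1 * 'I_d.+1 * 'I_d.+1) : nat :=
  (d.+1 * t.1.1 + (d - t.1.2))%N.

Lemma orbit_coef_diag d t : @orbit_coef d t t = 1.
Proof.
by rewrite /orbit_coef !leq_addr !addKn eqxx !binn.
Qed.

(** The first binomial being nonzero gives a' <= a. If a' = a, the guard gives c' = c and the second
    binomial gives b <= b', strictly because the triples differ. *)
Lemma orbit_coef_lt d s t : s != t -> @orbit_coef d s t != 0 ->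
  (orbit_rank t < orbit_rank s)%N.
Proof.
case: s t => [[a b] c] [[a' b'] c']; rewrite /orbit_coef /orbit_rank /=.
move=> nest; case: and3P => // -[h1 h2 /eqP h3].
have [le1|lt1] := leqP (a' + b' - a)%N b'; last by rewrite bin_small.
have [le2 _|lt2] := leqP b (a' + b' - a)%N; last by rewrite [X in (_ * X)%N]bin_small // muln0.
have := ltn_ord b'; have := ltn_ord b => ltb ltb'.
have [lta|lea] := ltnP a' a; first by nia.
have ea : a' = a by apply: val_inj => /=; lia.
have ec : c' = c by apply: val_inj => /=; move: h2 h3; rewrite ea; lia.
have neb : b != b' by apply: contraNneq nest => ->; rewrite ea ec.
have : (b : nat) != b' by [].
by rewrite ea in le2 *; rewrite addKn in le2; lia.
Qed.

Lemma du_entry_typ d (s : 'I_d.+1 * 'I_d.+1 * 'I_d.+1) (A B : {set 'I_d}) :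
  du_entry s.1.1 s.2 (fun n => 'C(n, s.1.2)%:R) A B = (orbit_coef s (typ A B))%:~R.
Proof.
rewrite /du_entry /orbit_coef /typ /= !inordK ?card_leq_ord //.
have -> : (#|A :\: B| + #|A :&: B| = #|A|)%N by rewrite addnC cardsID.
have -> : (#|B :\: A| + #|A :&: B| = #|B|)%N by rewrite addnC setIC cardsID.
by case: ifP => // _; rewrite -natrM.
Qed.

(** * The two bases and the equality of the two rings *)

Definition dp_basis d (t : 'I_d.+1 * 'I_d.+1 * 'I_d.+1) : 'M[rat]_(Nd d) :=
  dpow (Ff d) t.1.1 * binomT (H2 d) t.1.2 * dpow (Ee d) t.2.

Lemma dp_basis_comb d (c : 'I_d.+1 * 'I_d.+1 * 'I_d.+1 -> int) :
  \sum_(t | triple_ok t) (c t)%:~R *: dp_basis t =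
  mxS (fun A B => (\sum_(t | triple_ok t) c t * orbit_coef t (typ A B))%:~R).
Proof.
have dpE t : dp_basis t = mxS (fun A B => (orbit_coef t (typ A B))%:~R).
  rewrite /dp_basis dpow_Ff dpow_Ee binomT_H2 down_diag_up.
  by apply/mxS_eq => A B; rewrite du_entry_typ.
under eq_bigr do rewrite dpE mxSZ.
rewrite mxS_sum; apply/mxS_eq => A B.
by rewrite rmorph_sum; apply: eq_bigr => t _; rewrite rmorphM.
Qed.

Lemma gen_dp_basis d t : gen_dp (@dp_basis d t).
Proof.
apply: gen_mul (gen_e _ _); apply: gen_mul (gen_f _ _) _.
by rewrite binomT_H2; apply: gen_diagS.
Qed.

Lemma dp_basis_Zbasis d : is_Zbasis (@SZ d) (@triple_ok d) (@dp_basis d).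
Proof.
split=> [t _|M /SZ_typ[g ->]|c c0 t okt].
- exact/gen_SZ/gen_dp_basis.
- have [c cE] := unitriangular_span (fun t _ => orbit_coef_diag t)
    (fun s t _ _ => @orbit_coef_lt d s t) g (sel := @triple_ok d).
  exists c; rewrite dp_basis_comb; apply/mxS_eq => A B.
  by rewrite cE // triple_ok_typ.
apply: (unitriangular_free (fun t _ => orbit_coef_diag t)
    (fun s t _ _ => @orbit_coef_lt d s t) (sel := @triple_ok d)) okt => {}t okt.
(* Every admissible type occurs as that of a pair, so a zero matrix forces each type's coefficient
   to be 0. *)
have [A [B <-]] := typ_surj okt; apply/eqP; rewrite -(intr_eq0 rat); apply/eqP.
(* Zero is rewritten as 1 - 1 to bring it to the form [mxS] and compare entries. *)
move: c0; rewrite dp_basis_comb -[X in _ = X](subrr 1) -diagS1 diagSB => /mxS_eq->.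
by rewrite subrr if_same.
Qed.

Lemma SZ_gen d (M : 'M[rat]_(Nd d)) : SZ M <-> gen_dp M.
Proof.
split; last exact: gen_SZ.
have [_ span _] := dp_basis_Zbasis d; case/span=> c ->.
by apply: gen_sum => t _; apply/gen_intZ/gen_dp_basis.
Qed.

(** Complementation permutes the generators e^(m) and f^(m), so stability is inherited from the
    subring. *)
Lemma SZ_flip d (M : 'M[rat]_(Nd d)) : SZ M -> SZ (flip M).
Proof. by move/SZ_gen/gen_flip/SZ_gen. Qed.

Theorem theorem2p4 (d : nat) :
  (forall M : 'M[rat]_(Nd d), SZ M <-> gen_dp M) /\
  is_Zbasis (@SZ d) (@triple_ok d)
    (fun t => dpow (Ff d) t.1.1 * binomT (H2 d) t.1.2 * dpow (Ee d) t.2) /\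
  is_Zbasis (@SZ d) (@triple_ok d)
    (fun t => dpow (Ee d) t.1.1 * binomT (H1 d) t.1.2 * dpow (Ff d) t.2).
Proof.
split; first exact: SZ_gen.
split; first exact: dp_basis_Zbasis.
have [inSZ span free] := dp_basis_Zbasis d.
have flipE (t : 'I_d.+1 * 'I_d.+1 * 'I_d.+1) :
    dpow (Ee d) t.1.1 * binomT (H1 d) t.1.2 * dpow (Ff d) t.2 =
    flip (dp_basis t).
  by rewrite 2!flipM !flip_dpow flip_Ee flip_Ff binomT_H1.
have flip_comb (c : 'I_d.+1 * 'I_d.+1 * 'I_d.+1 -> int) : \sum_(t | triple_ok t) (c t)%:~R *:
    (dpow (Ee d) t.1.1 * binomT (H1 d) t.1.2 * dpow (Ff d) t.2) =
    flip (\sum_(t | triple_ok t) (c t)%:~R *: dp_basis t).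
  by rewrite flip_sum; apply: eq_bigr => t _; rewrite flipE flipZ.
split=> [t okt|M SZM|c c0].
- by rewrite flipE; apply/SZ_flip/inSZ.
(* Expand [flip M] in the first basis and flip back. *)
- have [c cE] := span _ (SZ_flip SZM).
  by exists c; rewrite flip_comb -cE flipK.
apply: free; rewrite -[LHS]flipK -flip_comb c0.
by rewrite /flip mulr0 mul0r.
Qed.
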